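(* Let $n$ be any positive integer and let $P=\mathscr{IPF}(\mathbb{N}^n)$ be the semigroup of all order isomorphisms between principal filters of $(\mathbb{N}^n,\leqslant)$. Then: (i) $P$ is an inverse semigroup; (ii) the semilattice $E(P)$ of idempotents of $P$ is isomorphic to $(\mathscr{P}_{\uparrow}(\mathbb{N}^n),\cap)$ by the mapping $\varepsilon\mapsto\operatorname{dom}\varepsilon$, and hence it is isomorphic to the semilattice $(\mathbb{N}^n,\max)$; (iii) $\alpha\mathscr{L}\beta$ in $P$ if and only if $\operatorname{ran}\alpha=\operatorname{ran}\beta$; (iv) $\alpha\mathscr{R}\beta$ in $P$ if and only if $\operatorname{dom}\alpha=\operatorname{dom}\beta$; (v) $\alpha\mathscr{H}\beta$ in $P$ if and only if $\operatorname{dom}\alpha=\operatorname{dom}\beta$ and $\operatorname{ran}\alpha=\operatorname{ran}\beta$; (vi) for any idempotents $\varepsilon,\iota\in P$ there exist $\alpha,\beta\in P$ such that $\alpha\beta=\varepsilon$ and $\beta\alpha=\iota$; (vii) $P$ is bisimple and hence it is simple.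
   Context: $\mathbb{N}$ is the set of positive integers; $(\mathbb{N}^n,\leqslant)$ carries the product (coordinatewise) order; for $\mathbf{x}\in\mathbb{N}^n$, ${\uparrow}\mathbf{x}=\{\mathbf{y}\in\mathbb{N}^n:\mathbf{x}\leqslant\mathbf{y}\}$ is the principal filter generated by $\mathbf{x}$. $\mathscr{IPF}(\mathbb{N}^n)$ is the set of all order isomorphisms $\alpha\colon{\uparrow}\mathbf{x}\to{\uparrow}\mathbf{y}$ with $\mathbf{x},\mathbf{y}\in\mathbb{N}^n$ (order isomorphism: a monotone bijection with monotone inverse), regarded as partial maps of $\mathbb{N}^n$ with $\operatorname{dom}\alpha={\uparrow}\mathbf{x}$, $\operatorname{ran}\alpha={\uparrow}\mathbf{y}$. The operation is composition of partial maps; maps are written on the right and composed left to right: $z(\alpha\beta)=(z\alpha)\beta$ for $z\in\operatorname{dom}(\alpha\beta)=\{z\in\operatorname{dom}\alpha: z\alpha\in\operatorname{dom}\beta\}$. $\mathscr{P}_{\uparrow}(\mathbb{N}^n)$ is the set of all principal filters of $(\mathbb{N}^n,\leqslant)$, with operation intersection; $(\mathbb{N}^n,\max)$ has the coordinatewise maximum as operation. Green's relations are standard: $a\mathscr{L}b$ iff $S^1a=S^1b$, $a\mathscr{R}b$ iff $aS^1=bS^1$, $\mathscr{H}=\mathscr{L}\cap\mathscr{R}$, $\mathscr{D}=\mathscr{L}\circ\mathscr{R}$. A semigroup is bisimple if it has only one $\mathscr{D}$-class, and simple if it has no proper two-sided ideals. *)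

(* Defs.v *)
From HB Require Import structures.
From mathcomp Require Import all_boot all_order.
From mathcomp Require Import boolp classical_sets functions.

Set Implicit Arguments.
Unset Strict Implicit.
Unset Printing Implicit Defensive.

Import Order.TTheory.

Local Open Scope order_scope.
Local Open Scope classical_set_scope.
Local Open Scope group_scope.

Section Semigroups.
Variable S : semigroupType.
Implicit Types a b c s : S.

Definition inverse_semigroup : Prop :=
  forall a, exists! b, a * b * a = a /\ b * a * b = b.

Definition idempotents : set S := [set e | e * e = e].

(* S^1 a and a S^1, the identity adjoined to S contributing a itself. *)
Definition left_ideal a : set S := [set b | b = a \/ exists s, b = s * a].
Definition right_ideal a : set S := [set b | b = a \/ exists s, b = a * s].

Definition greenL a b : Prop := left_ideal a = left_ideal b.
Definition greenR a b : Prop := right_ideal a = right_ideal b.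
Definition greenH a b : Prop := greenL a b /\ greenR a b.
Definition greenD a b : Prop := exists c, greenL a c /\ greenR c b.

Definition D_class a : set S := [set b | greenD a b].
Definition bisimple : Prop := exists C : set S, range D_class = [set C].

Definition two_sided_ideal (I : set S) : Prop :=
  I !=set0 /\ forall a s, I a -> I (s * a) /\ I (a * s).
Definition simple_semigroup : Prop :=
  forall I : set S, two_sided_ideal I -> I = setT.

End Semigroups.

Arguments idempotents : clear implicits.

Definition semilattice_on T (A : set T) (op : T -> T -> T) : Prop :=
  [/\ forall x y, A x -> A y -> A (op x y),
      forall x y z, A x -> A y -> A z -> op x (op y z) = op (op x y) z,
      forall x y, A x -> A y -> op x y = op y x
    & forall x, A x -> op x x = x].

Definition isomorphism_on T U (A : set T) (opA : T -> T -> T)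
    (B : set U) (opB : U -> U -> U) (f : T -> U) : Prop :=
  set_bij A B f /\
  forall x y, A x -> A y -> f (opA x y) = opB (f x) (f y).

Record posnat := PosNat { posnat_val :> nat; _ : (0 < posnat_val)%N }.

HB.instance Definition _ := [isSub for posnat_val].
HB.instance Definition _ := [Choice of posnat by <:].
HB.instance Definition _ :=
  [SubChoice_isSubOrder of posnat by <: with Order.Disp tt tt].

(* N^n; the order on tupleprod is the product order (see leEtprod). *)
Notation posvec n := (n.-tupleprod posnat).

Definition max_vec n (x y : posvec n) : posvec n :=
  [tuple Order.max (tnth x i) (tnth y i) | i < n].

Definition up n (x : posvec n) : set (posvec n) := [set y | x <= y].

Definition principal_filters n : set (set (posvec n)) := range (@up n).

Section PartialMaps.
Variable T : Type.
Implicit Types f g : T -> option T.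

Definition pdom f : set T := [set x | f x].
Definition pran f : set T := [set y | exists x, f x = Some y].

(* Maps act on the right: f is applied first. *)
Definition pmul f g : T -> option T := fun x => obind g (f x).

End PartialMaps.

Definition order_iso_between n (A B : set (posvec n))
    (f : posvec n -> option (posvec n)) : Prop :=
  [/\ pdom f = A,
      pran f = B,
      forall x y z, f x = Some z -> f y = Some z -> x = y,
      forall x y x' y', f x = Some x' -> f y = Some y' -> x <= y -> x' <= y'
    & forall x y x' y', f x = Some x' -> f y = Some y' -> x' <= y' -> x <= y].

Definition is_ipf n (f : posvec n -> option (posvec n)) : Prop :=
  exists x y : posvec n, order_iso_between (up x) (up y) f.

Record IPF n := MkIPF {
  pmap_of : posvec n -> option (posvec n);
  pmap_ofP : is_ipf pmap_of
}.

Definition dom n (a : IPF n) : set (posvec n) := pdom (pmap_of a).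
Definition ran n (a : IPF n) : set (posvec n) := pran (pmap_of a).

Lemma max_vec_le n (x y z : posvec n) :
  (max_vec x y <= z) = (x <= z) && (y <= z).
Proof.
rewrite !leEtprod; apply/forallP/andP => [h|[/forallP hx /forallP hy] i].
  split; apply/forallP => i; have := h i; rewrite tnth_mktuple ge_max.
    by case/andP.
  by case/andP.
by rewrite tnth_mktuple ge_max hx hy.
Qed.

Lemma up_max_vec n (x y : posvec n) : up x `&` up y = up (max_vec x y).
Proof.
apply/seteqP; split => z; rewrite /up /= max_vec_le; first by case=> -> ->.
by case/andP.
Qed.

Lemma is_ipf_pmul n (f g : posvec n -> option (posvec n)) :
  is_ipf f -> is_ipf g -> is_ipf (pmul f g).
Proof.
move=> [x [y [df rf fI fM fW]]] [u [v [dg rg gI gM gW]]].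
have yw : up y (max_vec y u).
  by have := lexx (max_vec y u); rewrite max_vec_le => /andP[].
have uw : up u (max_vec y u).
  by have := lexx (max_vec y u); rewrite max_vec_le => /andP[].
have [p fp] : pran f (max_vec y u) by rewrite rf.
have : pdom g (max_vec y u) by rewrite dg.
rewrite /pdom /=; case gw : (g (max_vec y u)) => [q|//] _.
have xp : x <= p.
  by have : pdom f p by [rewrite /pdom /= fp]; rewrite df.
have vq : v <= q.
  by have : pran g q by [exists (max_vec y u)]; rewrite rg.
have pmulS a b : pmul f g a = Some b -> exists2 c, f a = Some c & g c = Some b.
  by rewrite /pmul; case fa : (f a) => [c|//] /= gc; exists c.
have ranf a c : f a = Some c -> y <= c.
  by move=> fa; have : pran f c by [exists a]; rewrite rf.
have domg c b : g c = Some b -> u <= c.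
  by move=> gc; have : pdom g c by [rewrite /pdom /= gc]; rewrite dg.
exists p, q; split.
- apply/seteqP; split => a; rewrite /pdom /up /=.
    case e : (pmul f g a) => [b|//] _; have [c fa gc] := pmulS _ _ e.
    by apply: (fW _ _ _ _ fp fa); rewrite max_vec_le (ranf _ _ fa) (domg _ _ gc).
  move=> pa; have : pdom f a by rewrite df; exact: le_trans xp pa.
  rewrite /pdom /pmul /=; case fa : (f a) => [c|//] _ /=.
  have : pdom g c.
    by rewrite dg; apply: le_trans uw _; exact: (fM _ _ _ _ fp fa).
  by [].
- apply/seteqP; split => b; rewrite /pran /up /=.
    case=> a /pmulS[c fa gc].
    by apply: (gM _ _ _ _ gw gc); rewrite max_vec_le (ranf _ _ fa) (domg _ _ gc).
  move=> qb; have [c gc] : pran g b by rewrite rg; exact: le_trans vq qb.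
  have [a fa] : pran f c.
    by rewrite rf; apply: le_trans yw _; exact: (gW _ _ _ _ gw gc).
  by exists a; rewrite /pmul fa.
- move=> a b c /pmulS[a' fa ga] /pmulS[b' fb gb].
  by rewrite -(gI _ _ _ ga gb) in fb; exact: (fI _ _ _ fa fb).
- move=> a b a' b' /pmulS[c fa gc] /pmulS[d fb gd] ab.
  by apply: (gM _ _ _ _ gc gd); exact: (fM _ _ _ _ fa fb).
- move=> a b a' b' /pmulS[c fa gc] /pmulS[d fb gd] ab.
  by apply: (fW _ _ _ _ fa fb); exact: (gW _ _ _ _ gc gd).
Qed.

Lemma IPF_eq n (a b : IPF n) : pmap_of a = pmap_of b -> a = b.
Proof.
case: a b => [f Pf] [g Pg] /= e; subst g.
by congr MkIPF; exact: Prop_irrelevance.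
Qed.

Definition IPF_mul n (a b : IPF n) : IPF n :=
  MkIPF (is_ipf_pmul (pmap_ofP a) (pmap_ofP b)).

Lemma IPF_mulA n : associative (@IPF_mul n).
Proof.
move=> a b c; apply: IPF_eq; apply/funext => x /=.
by rewrite /pmul; case: (pmap_of a x).
Qed.

HB.instance Definition _ n := gen_eqMixin (IPF n).
HB.instance Definition _ n := gen_choiceMixin (IPF n).
HB.instance Definition _ n := isSemigroup.Build (IPF n) (@IPF_mulA n).

(* Main.v *)
(** Every element of [IPF n] is an injective partial map and the converse of an
    element is again an element, so [IPF n] is an inverse semigroup of partial
    injections: its idempotents are the partial identities on principal
    filters, and ranges and domains decide Green's relations.  The translation
    [z |-> z - x + y] maps the filter of [x] onto that of [y], so every pair
    (domain, range) is realised; this gives (vi) and bisimplicity. *)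
Require Import Defs.
From HB Require Import structures.
From mathcomp Require Import all_boot all_order.
From mathcomp Require Import boolp classical_sets functions.

Set Implicit Arguments.
Unset Strict Implicit.
Unset Printing Implicit Defensive.

Import Order.TTheory.

Local Open Scope order_scope.
Local Open Scope classical_set_scope.
Local Open Scope group_scope.

(** * Green's relations in an arbitrary semigroup *)

Section GreenRelations.
Variable S : semigroupType.
Implicit Types a b s : S.

Lemma left_ideal_sub a b : left_ideal b a -> left_ideal a `<=` left_ideal b.
Proof.
case=> [->//|[s ->]] c [->|[t ->]]; right; first by exists s.
by exists (t * s); rewrite mulgA.
Qed.

Lemma right_ideal_sub a b : right_ideal b a -> right_ideal a `<=` right_ideal b.
Proof.
case=> [->//|[s ->]] c [->|[t ->]]; right; first by exists s.
by exists (s * t); rewrite mulgA.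
Qed.

Lemma greenLP a b : greenL a b <-> left_ideal b a /\ left_ideal a b.
Proof.
split=> [ab|[ba ab]]; last by apply/seteqP; split; exact: left_ideal_sub.
by split; [rewrite -ab|rewrite ab]; left.
Qed.

Lemma greenRP a b : greenR a b <-> right_ideal b a /\ right_ideal a b.
Proof.
split=> [ab|[ba ab]]; last by apply/seteqP; split; exact: right_ideal_sub.
by split; [rewrite -ab|rewrite ab]; left.
Qed.

Lemma greenD_refl a : greenD a a.
Proof. by exists a. Qed.

Lemma bisimple_greenD a b : bisimple S -> greenD a b.
Proof.
case=> C DC; have DE c : D_class c = C.
  by have : range (@D_class S) (D_class c) by [exists c]; rewrite DC.
have : D_class b b by exact: greenD_refl.
by rewrite DE -(DE a).
Qed.

(** An ideal containing [a] reaches any [b] in two moves: the intermediate [c] of [greenD a b] lies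
    in $S^1 a$, and [b] lies in $c S^1$. *)
Lemma bisimple_simple : bisimple S -> simple_semigroup S.
Proof.
move=> bS I [[a Ia] idI]; apply/seteqP; split=> // b _.
have [c [/greenLP[_ ac] /greenRP[_ cb]]] := bisimple_greenD a b bS.
have Ic : I c by case: ac => [->//|[s ->]]; exact: (idI _ s Ia).1.
by case: cb => [->//|[s ->]]; exact: (idI _ s Ic).2.
Qed.

End GreenRelations.

(** * Graphs and converses of partial maps *)

Section PartialMapTheory.
Variable T : Type.
Implicit Types f g : T -> option T.

Lemma pmap_ext f g : (forall x y, f x = Some y <-> g x = Some y) -> f = g.
Proof.
move=> fg; apply/funext => x; case fx: (f x) => [y|].
  by apply/esym/fg.
by case gx: (g x) => [y|//]; move/fg: gx; rewrite fx.
Qed.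

Lemma pdomP f x : pdom f x <-> exists y, f x = Some y.
Proof.
rewrite /pdom /=; case: (f x) => [y|]; last by split=> // -[].
by split=> // _; exists y.
Qed.

Lemma pmulP f g x z :
  pmul f g x = Some z <-> exists2 y, f x = Some y & g y = Some z.
Proof.
rewrite /pmul; case fx: (f x) => [y|] /=; last by split=> // -[].
by split=> [gy|[_ [<-]]//]; exists y.
Qed.

(** The preimage is picked by classical choice, so the graph is the converse of that of [f] once [f]
    is injective. *)
Definition pinv f : T -> option T := fun y =>
  if pselect (exists x, f x = Some y) is left h
  then Some (projT1 (cid h)) else None.

Lemma pinvP f : (forall x y z, f x = Some z -> f y = Some z -> x = y) ->
  forall x y, pinv f y = Some x <-> f x = Some y.
Proof.
move=> fI x y; rewrite /pinv; case: pselect => [h|nh]; last first.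
  by split=> // fx; case: nh; exists x.
case: cid => x' /= fx'; split=> [[<-]//|fx].
by rewrite (fI _ _ _ fx fx').
Qed.

End PartialMapTheory.

(** * Translations between principal filters *)

Section Translation.
Variable n : nat.
Implicit Types x y z : posvec n.

Lemma posnat_gt0 (k : posnat) : (0 < k)%N.
Proof. by case: k. Qed.

Lemma leEposnat (k l : posnat) : (k <= l) = (k <= l)%N.
Proof. by rewrite -Order.le_val. Qed.

Lemma le_vecP x y : reflect (forall i, (tnth x i <= tnth y i)%N) (x <= y).
Proof.
rewrite leEtprod; apply: (iffP forallP) => h i; have := h i;
  by rewrite leEposnat.
Qed.

Lemma up_inj : injective (@up n).
Proof.
move=> x y xy; apply: le_anti; apply/andP; split.
  by have : up y y by [exact: lexx]; rewrite -xy.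
by have : up x x by [exact: lexx]; rewrite xy.
Qed.

Lemma addn_posnat_gt0 (m : nat) (k : posnat) : (0 < m + k)%N.
Proof. by rewrite addn_gt0 posnat_gt0 orbT. Qed.

(** Natural subtraction truncates, so this is the shift by [y - x] only on the filter of [x]; adding
    the positive coordinate of [y] last keeps the result positive for arbitrary [z]. *)
Definition translate x y z : posvec n :=
  [tuple PosNat (addn_posnat_gt0 (tnth z i - tnth x i) (tnth y i)) | i < n].

Definition ptranslate x y z : option (posvec n) :=
  if x <= z then Some (translate x y z) else None.

Lemma tnth_translate x y z i :
  tnth (translate x y z) i = (tnth z i - tnth x i + tnth y i)%N :> nat.
Proof. by rewrite tnth_mktuple. Qed.

Lemma translateK x y z : x <= z -> translate y x (translate x y z) = z.
Proof.
move=> /le_vecP xz; apply: eq_from_tnth => i; apply: val_inj => /=.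
by rewrite !tnth_translate addnK subnK.
Qed.

Lemma le_translate x y z : y <= translate x y z.
Proof. by apply/le_vecP => i; rewrite tnth_translate leq_addl. Qed.

Lemma translate_homo x y z z' :
  z <= z' -> translate x y z <= translate x y z'.
Proof.
move=> /le_vecP zz; apply/le_vecP => i; rewrite !tnth_translate.
by rewrite leq_add2r leq_sub2r.
Qed.

Lemma ptranslateP x y z t :
  ptranslate x y z = Some t <-> x <= z /\ translate x y z = t.
Proof.
rewrite /ptranslate; case: ifP => xz; last by split=> // -[].
by split=> [[->]|[_ ->]].
Qed.

Lemma order_iso_ptranslate x y :
  order_iso_between (up x) (up y) (ptranslate x y).
Proof.
(* Reflection of the order comes first: the opposite translation is monotone and undoes this one.
   Injectivity then follows by antisymmetry. *)
have W z z' t t' : ptranslate x y z = Some t -> ptranslate x y z' = Some t' ->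
    t <= t' -> z <= z'.
  move=> /ptranslateP[xz <-] /ptranslateP[xz' <-] /(@translate_homo y x).
  by rewrite !translateK.
split=> //.
- apply/seteqP; split=> z; first by case/pdomP=> t /ptranslateP[].
  by move=> xz; apply/pdomP; exists (translate x y z); apply/ptranslateP.
- apply/seteqP; split=> t.
    by case=> z /ptranslateP[_ <-]; exact: le_translate.
  move=> yt; exists (translate y x t); apply/ptranslateP.
  by rewrite translateK//; split=> //; exact: le_translate.
- move=> z z' t zt z't; apply: le_anti.
  by rewrite (W _ _ _ _ zt z't)// (W _ _ _ _ z't zt).
- move=> z z' t t' /ptranslateP[xz <-] /ptranslateP[xz' <-].
  exact: translate_homo.
Qed.

Definition IPF_translate x y : IPF n :=
  MkIPF (ex_intro _ x (ex_intro _ y (order_iso_ptranslate x y))).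

Lemma dom_translate x y : dom (IPF_translate x y) = up x.
Proof. by case: (order_iso_ptranslate x y). Qed.

Lemma ran_translate x y : ran (IPF_translate x y) = up y.
Proof. by case: (order_iso_ptranslate x y). Qed.

End Translation.

(** * Converses and the inverse semigroup structure *)

Section InverseSemigroup.
Variable n : nat.
Implicit Types (a b c e : IPF n) (x y z : posvec n).

Lemma IPF_ext a b :
  (forall x y, pmap_of a x = Some y <-> pmap_of b x = Some y) -> a = b.
Proof. by move=> ab; apply/IPF_eq/pmap_ext. Qed.

Lemma IPF_mulP a b x z : pmap_of (a * b) x = Some z <->
  exists2 y, pmap_of a x = Some y & pmap_of b y = Some z.
Proof. exact: pmulP. Qed.

Lemma IPF_inj a x y z :
  pmap_of a x = Some z -> pmap_of a y = Some z -> x = y.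
Proof. by have [u [v [_ _ fI _ _]]] := pmap_ofP a; exact: fI. Qed.

Lemma domP a x : dom a x <-> exists y, pmap_of a x = Some y.
Proof. exact: pdomP. Qed.

Lemma dom_up a : exists x, dom a = up x.
Proof. by have [u [v [df _ _ _ _]]] := pmap_ofP a; exists u. Qed.

Lemma ran_up a : exists x, ran a = up x.
Proof. by have [u [v [_ rf _ _ _]]] := pmap_ofP a; exists v. Qed.

(** Passing to the converse swaps domain with range and preservation with reflection of the order;
    injectivity of the converse is single-valuedness of [a]. *)
Lemma is_ipf_pinv a : is_ipf (pinv (pmap_of a)).
Proof.
have invP := pinvP (@IPF_inj a).
have [u [v [da ra _ aM aW]]] := pmap_ofP a.
exists v, u; split.
- rewrite -ra; apply/seteqP; split=> y.
    by case/pdomP=> x /invP ax; exists x.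
  by case=> x ax; apply/pdomP; exists x; apply/invP.
- rewrite -da; apply/seteqP; split=> x.
    by case=> y /invP ax; apply/pdomP; exists y.
  by case/pdomP=> y ax; exists y; apply/invP.
- by move=> x y z /invP ax /invP; rewrite ax => -[].
- by move=> x y x' y' /invP ax /invP ay; exact: aW ax ay.
- by move=> x y x' y' /invP ax /invP ay; exact: aM ax ay.
Qed.

Definition IPF_inv a : IPF n := MkIPF (is_ipf_pinv a).

Lemma IPF_invP a x y :
  pmap_of (IPF_inv a) y = Some x <-> pmap_of a x = Some y.
Proof. exact: (pinvP (@IPF_inj a)). Qed.

Lemma IPF_mulVP a x z :
  pmap_of (a * IPF_inv a) x = Some z <-> dom a x /\ x = z.
Proof.
rewrite IPF_mulP domP; split=> [[y ax /IPF_invP az]|[[y ax] <-]].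
  by split; [exists y|exact: IPF_inj ax az].
by exists y => //; apply/IPF_invP.
Qed.

Lemma IPF_Vmul_P a y z :
  pmap_of (IPF_inv a * a) y = Some z <-> ran a y /\ y = z.
Proof.
rewrite IPF_mulP; split=> [[x /IPF_invP ax az]|[[x ax] <-]].
  by split; [exists x|move: az; rewrite ax => -[]].
by exists x => //; apply/IPF_invP.
Qed.

(** The product [a * IPF_inv a] is the identity on [dom a], and [b] is applied after it. *)
Lemma IPF_mulVK a b : dom b `<=` dom a -> a * IPF_inv a * b = b.
Proof.
move=> ba; apply: IPF_ext => x z; rewrite IPF_mulP.
split=> [[y /IPF_mulVP[_ <-]]//|bx].
by exists x => //; apply/IPF_mulVP; split=> //; apply/ba/domP; exists z.
Qed.

Lemma IPF_mulKV a b : ran b `<=` ran a -> b * (IPF_inv a * a) = b.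
Proof.
move=> ba; apply: IPF_ext => x z; rewrite IPF_mulP.
split=> [[y bx /IPF_Vmul_P[_ <-]]//|bx].
by exists z => //; apply/IPF_Vmul_P; split=> //; apply/ba; exists x.
Qed.

Lemma dom_mul_sub a b : dom (a * b) `<=` dom a.
Proof. by move=> x /domP[z /IPF_mulP[y ax _]]; apply/domP; exists y. Qed.

Lemma ran_mul_sub a b : ran (a * b) `<=` ran b.
Proof. by move=> z [x /IPF_mulP[y _ yz]]; exists y. Qed.

(** Evaluating at [x], the map [b] must send [y] to a point with the same image under [a] as [x],
    which is [x] by injectivity. Used with [a] and [b] in both roles, this forces a generalized
    inverse to be the converse. *)
Lemma generalized_inverse_sub a b x y : a * b * a = a ->
  pmap_of a x = Some y -> pmap_of b y = Some x.
Proof.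
move=> aba axy; have := axy; rewrite -{1}aba.
case/IPF_mulP=> x' /IPF_mulP[y' ay' bx'] ax'.
move: ay' bx'; rewrite axy => -[<-].
by rewrite (IPF_inj axy ax').
Qed.

Lemma IPF_inverse_semigroup : inverse_semigroup (IPF n).
Proof.
move=> a; exists (IPF_inv a); split.
  split; first exact: IPF_mulVK.
  apply: IPF_ext => y x; rewrite IPF_mulP.
  split=> [[z /IPF_Vmul_P[_ <-]]//|ay].
  by exists y => //; apply/IPF_Vmul_P; split=> //; exists x; apply/IPF_invP.
move=> b [aba bab]; apply: IPF_ext => y x; rewrite IPF_invP.
by split; exact: generalized_inverse_sub.
Qed.

(** * Idempotents as partial identities *)

Lemma idempotentP e : idempotents (IPF n) e <->
  forall x z, pmap_of e x = Some z <-> dom e x /\ x = z.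
Proof.
split=> [ee x z|eP].
  (* If [e] sends [u] to [w], then [e * e = e] makes [w] a fixed point; so [u] and [w] have the same
     image and coincide by injectivity. *)
  have id_e u v : pmap_of e u = Some v -> u = v.
    rewrite -{1}ee => /IPF_mulP[w euw ewv].
    have := euw; rewrite -{1}ee => /IPF_mulP[w'].
    rewrite euw => -[<-] eww; move: ewv; rewrite eww => -[<-].
    exact: IPF_inj euw eww.
  split=> [ex|[/domP[y ey] <-]].
    by split; [apply/domP; exists z|exact: id_e].
  by rewrite {2}(id_e _ _ ey).
apply: IPF_ext => x z; rewrite IPF_mulP.
split=> [[y /eP[_ <-]]//|ex]; exists x => //; apply/eP; split=> //.
by apply/domP; exists z.
Qed.

Lemma idempotent_mulV a : idempotents (IPF n) (a * IPF_inv a).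
Proof. by rewrite /idempotents /= mulgA IPF_mulVK. Qed.

Lemma idempotent_dom_inj : {in idempotents (IPF n) &, injective (@dom n)}.
Proof.
move=> e f; rewrite !inE => /idempotentP eP /idempotentP fP ef.
by apply: IPF_ext => x z; rewrite eP fP ef.
Qed.

Lemma idempotent_mulP e f x z :
  idempotents (IPF n) e -> idempotents (IPF n) f ->
  pmap_of (e * f) x = Some z <-> (dom e `&` dom f) x /\ x = z.
Proof.
move=> /idempotentP eP /idempotentP fP; rewrite IPF_mulP.
split=> [[y /eP[ex <-] /fP[fx <-]]//|[[ex fx] <-]].
by exists x; [apply/eP|apply/fP].
Qed.

Lemma dom_idempotent_mul e f :
  idempotents (IPF n) e -> idempotents (IPF n) f ->
  dom (e * f) = dom e `&` dom f.
Proof.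
move=> ie jf; apply/seteqP; split=> x.
  by case/domP=> z /(idempotent_mulP _ _ ie jf)[].
by move=> ex; apply/domP; exists x; apply/(idempotent_mulP _ _ ie jf).
Qed.

Lemma idempotent_mul e f :
  idempotents (IPF n) e -> idempotents (IPF n) f ->
  idempotents (IPF n) (e * f).
Proof.
move=> ie jf; apply/idempotentP => x z.
by rewrite dom_idempotent_mul //; exact: idempotent_mulP.
Qed.

(** * The three semilattices and their isomorphisms *)

Lemma semilattice_idempotents :
  semilattice_on (idempotents (IPF n)) (@mul (IPF n)).
Proof.
split=> [|e f g _ _ _|e f ie jf|//]; first exact: idempotent_mul.
  exact: mulgA.
(* Commutativity is pulled back from intersection of domains, which determine idempotents. *)
by apply: idempotent_dom_inj; rewrite ?inE; [exact: idempotent_mul..|];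
  rewrite !dom_idempotent_mul // setIC.
Qed.

Lemma semilattice_principal_filters :
  semilattice_on (@principal_filters n) setI.
Proof.
split=> [_ _ [x _ <-] [y _ <-]|A B C _ _ _|A B _ _|A _].
- by rewrite up_max_vec; exists (max_vec x y).
- by rewrite setIA.
- by rewrite setIC.
- by rewrite setIid.
Qed.

Lemma semilattice_max_vec : semilattice_on setT (@max_vec n).
Proof.
(* The injective map [up] turns maxima into intersections, so the laws are inherited from those of
   sets. *)
by split=> [//|x y z _ _ _|x y _ _|x _]; apply: up_inj; rewrite -!up_max_vec;
  rewrite ?setIA ?setIid // setIC.
Qed.

Lemma idempotent_of_up x : exists2 e, idempotents (IPF n) e & dom e = up x.
Proof.
exists (IPF_translate x x * IPF_inv (IPF_translate x x)).
  exact: idempotent_mulV.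
apply/seteqP; rewrite -(dom_translate x x); split; first exact: dom_mul_sub.
by move=> z xz; apply/domP; exists z; apply/IPF_mulVP.
Qed.

Lemma isomorphism_dom : isomorphism_on (idempotents (IPF n)) (@mul (IPF n))
  (@principal_filters n) setI (@dom n).
Proof.
split; last exact: dom_idempotent_mul.
split; first by move=> e _; have [x ->] := dom_up e; exists x.
  exact: idempotent_dom_inj.
by move=> _ [x _ <-]; have [e ie <-] := idempotent_of_up x; exists e.
Qed.

(** The generator of the filter [dom a], unique by [up_inj]; on idempotents this is [dom] followed
    by the inverse of [up]. *)
Definition dom_min a : posvec n := projT1 (cid (dom_up a)).

Lemma up_dom_min a : up (dom_min a) = dom a.
Proof. by rewrite /dom_min; case: cid. Qed.

Lemma isomorphism_dom_min : isomorphism_on (idempotents (IPF n)) (@mul (IPF n))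
  setT (@max_vec n) dom_min.
Proof.
split=> [|e f ie jf]; last first.
  by apply: up_inj; rewrite -up_max_vec !up_dom_min dom_idempotent_mul.
split=> // [e f ie jf ef|x _].
  by apply: idempotent_dom_inj => //; rewrite -!up_dom_min ef.
have [e ie ex] := idempotent_of_up x.
by exists e => //; apply: up_inj; rewrite up_dom_min.
Qed.

(** * Principal ideals, Green's relations and bisimplicity *)

Lemma left_ideal_ran a b : left_ideal b a <-> ran a `<=` ran b.
Proof.
split=> [[->//|[s ->]]|ab]; first exact: ran_mul_sub.
(* Since [IPF_inv b * b] is the identity on [ran b], right multiplication by it fixes [a]. *)
by right; exists (a * IPF_inv b); rewrite -mulgA IPF_mulKV.
Qed.

Lemma right_ideal_dom a b : right_ideal b a <-> dom a `<=` dom b.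
Proof.
split=> [[->//|[s ->]]|ab]; first exact: dom_mul_sub.
by right; exists (IPF_inv b * a); rewrite mulgA IPF_mulVK.
Qed.

Lemma greenL_ran a b : greenL a b <-> ran a = ran b.
Proof. by rewrite greenLP !left_ideal_ran seteqP. Qed.

Lemma greenR_dom a b : greenR a b <-> dom a = dom b.
Proof. by rewrite greenRP !right_ideal_dom seteqP. Qed.

Lemma idempotents_factor e f :
  idempotents (IPF n) e -> idempotents (IPF n) f ->
  exists a b, a * b = e /\ b * a = f.
Proof.
move=> /idempotentP eP /idempotentP fP.
have [x ex] := dom_up e; have [y fy] := dom_up f.
(* The two products are the identities on the filters of [x] and [y], that is, on the domains of [e]
   and [f]. *)
exists (IPF_translate x y), (IPF_inv (IPF_translate x y)).
split; apply: IPF_ext => u v.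
  by rewrite IPF_mulVP eP dom_translate ex.
by rewrite IPF_Vmul_P fP ran_translate fy.
Qed.

Lemma greenD_total a b : greenD a b.
Proof.
have [y ay] := ran_up a; have [x bx] := dom_up b.
(* This translation starts on [dom b] and ends on [ran a], so it links [a] to [b]. *)
exists (IPF_translate x y); split.
  by apply/greenL_ran; rewrite ran_translate.
by apply/greenR_dom; rewrite dom_translate.
Qed.

Lemma IPF_bisimple : bisimple (IPF n).
Proof.
have DT a : D_class a = setT.
  by apply/seteqP; split=> // b _; exact: greenD_total.
exists setT; apply/seteqP; split=> [_ [a _ <-]|_ ->]; first exact: DT.
(* The family of classes equals a singleton only if some element exists; the all-ones vector
   supplies one. *)
pose one : posvec n := [tuple PosNat (ltn0Sn 0) | _ < n].
by exists (IPF_translate one one) => //; exact: DT.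
Qed.

End InverseSemigroup.

Theorem proposition2p1 (n : nat) (n_gt0 : (0 < n)%N) :
  (* (i) *)
  inverse_semigroup (IPF n) /\
  (* (ii) *)
  (semilattice_on (idempotents (IPF n)) (@mul (IPF n)) /\
   semilattice_on (@principal_filters n) setI /\
   isomorphism_on (idempotents (IPF n)) (@mul (IPF n))
                  (@principal_filters n) setI (@dom n) /\
   semilattice_on setT (@max_vec n) /\
   exists f : IPF n -> n.-tupleprod posnat,
     isomorphism_on (idempotents (IPF n)) (@mul (IPF n)) setT (@max_vec n) f) /\
  (* (iii) *)
  (forall a b : IPF n, greenL a b <-> ran a = ran b) /\
  (* (iv) *)
  (forall a b : IPF n, greenR a b <-> dom a = dom b) /\
  (* (v) *)
  (forall a b : IPF n, greenH a b <-> dom a = dom b /\ ran a = ran b) /\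
  (* (vi) *)
  (forall e i : IPF n, idempotents (IPF n) e -> idempotents (IPF n) i ->
     exists a b : IPF n, (a * b)%g = e /\ (b * a)%g = i) /\
  (* (vii) *)
  bisimple (IPF n) /\ simple_semigroup (IPF n).
Proof.
split; first exact: IPF_inverse_semigroup.
split.
  split; first exact: semilattice_idempotents.
  split; first exact: semilattice_principal_filters.
  split; first exact: isomorphism_dom.
  split; first exact: semilattice_max_vec.
  by exists (@dom_min n); exact: isomorphism_dom_min.
split; first exact: greenL_ran.
split; first exact: greenR_dom.
split; first by move=> a b; rewrite /greenH greenL_ran greenR_dom and_comm.
split; first exact: idempotents_factor.
split; first exact: IPF_bisimple.
exact/bisimple_simple/IPF_bisimple.
Qed.
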